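(* Let $K$ be a field of characteristic $p$, and let $f\in K[X,Y,Z]$ be an irreducible polynomial of prime degree $d$, with $d$ not divisible by $p$. Let $f_d$ be its homogeneous component of maximal degree, and suppose that there is a polynomial $g(Y,Z)\in K[Y,Z]$ such that: (1) $f_d$ is irreducible; (2) $f_d(X,Y,Z)=X^d+g(Y,Z)$; (3) $g(Y,Z)$ is irreducible. Then $\dim\mathcal{R}(K[X,Y,Z]/(f))=2$.
   Context: For an integral domain $D$ with quotient field $Q(D)$, the reciprocal complement $\mathcal{R}(D)$ is the subring of $Q(D)$ generated by all $1/x$ with $x\in D\setminus\{0\}$; $\dim$ denotes Krull dimension. Irreducibility of polynomials is over $K$. *)

(* Defs.v *)
From HB Require Import structures.
From mathcomp Require Import all_boot all_algebra.
From mathcomp.classical Require Import boolp.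
From mathcomp.multinomials Require Export mpoly.

Set Implicit Arguments.
Unset Strict Implicit.
Unset Printing Implicit Defensive.

Import GRing.Theory.
Local Open Scope ring_scope.

(* The ideal generated by an irreducible polynomial is proved prime below: a   *)
(* polynomial ring over a factorial domain is factorial (Gauss), so the same   *)
(* holds for {mpoly K[n]}.  This is what makes K[X_1,..,X_n]/(f) an idomainType. *)

Section Divisibility.
Variable A : idomainType.
Implicit Types a b c : A.

Definition divides a b := exists c, b = c * a.

Definition irreducible_elt a :=
  [/\ a != 0, a \isn't a GRing.unit &
    forall b c, a = b * c -> b \is a GRing.unit \/ c \is a GRing.unit].

Definition prime_elt a :=
  [/\ a != 0, a \isn't a GRing.unit &
    forall b c, divides a (b * c) -> divides a b \/ divides a c].

Inductive prime_prod : A -> Prop :=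
| PrimeProdUnit u : u \is a GRing.unit -> prime_prod u
| PrimeProdMul p a : prime_elt p -> prime_prod a -> prime_prod (p * a).

Definition factorial_domain := forall a, a != 0 -> prime_prod a.

Lemma irreducible_prime : factorial_domain ->
  forall a, irreducible_elt a -> prime_elt a.
Proof.
move=> fA a [a0 aU irr]; have fa := fA a a0; case: fa a0 aU irr => [u -> //|p b pp _] pb0 _ irr.
have [p0 pU pdiv] := pp.
have [pU'|bU] := irr p b erefl; first by rewrite pU' in pU.
have pbU : p * b \isn't a GRing.unit by rewrite unitrM (negPf pU).
split=> // x y [c exy].
have [] := pdiv x y; first by exists (c * b); rewrite exy -mulrA [p * b]mulrC.
- by case=> z ->; left; exists (z / b); rewrite [p * b]mulrC mulrA divrK.
- by case=> z ->; right; exists (z / b); rewrite [p * b]mulrC mulrA divrK.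
Qed.

Lemma prime_prodM a b : prime_prod a -> prime_prod b -> prime_prod (a * b).
Proof.
elim=> [u uU|p c pp _ IH] pb; last by rewrite -mulrA; constructor=> //; exact: IH.
case: pb => [v vU|p c [p0 pU pd] pc]; first by constructor; rewrite unitrM uU.
rewrite mulrA; constructor=> //; split.
- by rewrite mulf_neq0 //; apply: contraTneq uU => ->; rewrite unitr0.
- by rewrite unitrM uU.
have eqd x : divides (u * p) x <-> divides p x.
  split=> -[z ->]; first by exists (z * u); rewrite mulrA.
  by exists (z / u); rewrite mulrA divrK.
by move=> x y; rewrite !eqd; apply: pd.
Qed.

End Divisibility.

Section FactorialPoly.
Variable A : idomainType.
Implicit Types p q r : {poly A}.

Lemma divides_polyC (a : A) p :
  divides a%:P p <-> forall i, divides a p`_i.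
Proof.
split=> [[q -> i]|dp]; first by exists q`_i; rewrite coefMC.
have [c ec] := choice dp.
exists (\poly_(i < size p) c i); apply/polyP => i.
rewrite coefMC coef_poly; case: ltnP => [_|le]; first exact: ec.
by rewrite mul0r nth_default.
Qed.

Lemma divides_add (a x y : A) : divides a x -> divides a y -> divides a (x + y).
Proof. by move=> [u ->] [v ->]; exists (u + v); rewrite mulrDl. Qed.

Lemma divides_mull (a x y : A) : divides a x -> divides a (y * x).
Proof. by move=> [u ->]; exists (y * u); rewrite mulrA. Qed.

Lemma divides_mulr (a x y : A) : divides a x -> divides a (x * y).
Proof. by rewrite mulrC; exact: divides_mull. Qed.

Lemma divides_sub (a x y : A) : divides a (x + y) -> divides a x -> divides a y.
Proof. by move=> [u e] [v f]; exists (u - v); rewrite mulrBl -e -f addrC addKr. Qed.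

Lemma prime_polyC (a : A) : prime_elt a -> prime_elt a%:P.
Proof.
move=> [a0 aU ad]; split; first by rewrite polyC_eq0.
  by rewrite poly_unitE coefC eqxx (negPf aU) andbF.
move=> p q dpq.
apply: contrapT => /not_orP[np nq].
have minimal r : ~ divides a%:P r ->
    exists i, ~ divides a r`_i /\ forall k, (k < i)%N -> divides a r`_k.
  move=> nr; have ex : exists i, ~~ `[< divides a r`_i >].
    apply: contrapT => /forallNP h; apply: nr; apply/divides_polyC => i.
    by apply: contrapT => hi; apply: (h i); apply/asboolPn.
  case: (ex_minnP ex) => i /asboolPn ni mi; exists i; split=> // k ki.
  by apply: contrapT => /asboolPn /mi; rewrite leqNgt ki.
have [i [ni mi]] := minimal _ np; have [j [nj mj]] := minimal _ nq.
have /divides_polyC /(_ (i + j)%N) := dpq.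
have ij : (i < (i + j).+1)%N by rewrite ltnS leq_addr.
rewrite coefM (bigD1 (Ordinal ij)) //= addKn addrC => dsum.
have : divides a (p`_i * q`_j).
  apply: (divides_sub dsum).
  elim/big_ind: _ => [||k ki]; first by exists 0; rewrite mul0r.
    exact: divides_add.
  case: (ltnP k i) => [lt|ge]; first exact/divides_mulr/mi.
  apply/divides_mull/mj; rewrite ltn_subLR; last by rewrite -ltnS.
  rewrite ltn_add2r ltn_neqAle ge andbT.
  by apply: contraNneq ki => e; apply/eqP/val_inj.
by case/ad.
Qed.

Lemma prime_prod_polyC (a : A) : prime_prod a -> prime_prod a%:P.
Proof.
elim=> [u uU|p b pp _ IH]; first exact/PrimeProdUnit/(rmorph_unit polyC).
by rewrite polyCM; apply: PrimeProdMul => //; exact: prime_polyC.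
Qed.

Definition primitive p := forall a, prime_elt a -> ~ divides a%:P p.

Lemma prime_polyC_neq0 (a : A) : prime_elt a -> a%:P != 0.
Proof. by case=> a0 _ _; rewrite polyC_eq0. Qed.

(* A factorisation of c * p in {poly A} yields one of p with the same degrees. *)
Lemma strip (c : A) p q r : prime_prod c -> c%:P * p = q * r ->
  exists q' r', [/\ p = q' * r', size q' = size q & size r' = size r].
Proof.
move=> pc; elim: pc q r => [u uU|a b pa _ IH] q r e.
  exists (u^-1 *: q), r; split=> //.
    by rewrite -scalerAl -e -mul_polyC mulrA -polyCM mulVr // mul1r.
  by rewrite size_scale // invr_eq0; apply: contraTneq uU => ->; rewrite unitr0.
have [_ _ /(_ q r)] := prime_polyC pa.
have a0 := prime_polyC_neq0 pa; have a0' : a != 0 by rewrite -polyC_eq0.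
case.
- by exists (b%:P * p); rewrite -e polyCM -mulrA mulrC.
- case=> q1 eq; have [|q' [r' [-> sq sr]]] := IH q1 r.
    by apply: (mulfI a0); rewrite mulrA -polyCM e eq [RHS]mulrA [q1 * _]mulrC.
  by exists q', r'; split=> //; rewrite sq eq mulrC mul_polyC size_scale.
- case=> r1 er; have [|q' [r' [-> sq sr]]] := IH q r1.
    by apply: (mulfI a0); rewrite mulrA -polyCM e er mulrA mulrC.
  by exists q', r'; split=> //; rewrite sr er mulrC mul_polyC size_scale.
Qed.

Lemma primitive_cancel (c : A) p a b : prime_prod c -> primitive p ->
  c%:P * a = b * p -> divides p a.
Proof.
move=> pc pp; elim: pc b => [u uU|x y px _ IH] b e.
  exists (u^-1%:P * b); rewrite -mulrA -e mulrA -polyCM mulVr // mul1r //.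
have [_ _ /(_ b p)] := prime_polyC px.
case; first by exists (y%:P * a); rewrite -e polyCM -mulrA mulrC.
  case=> b1 eb; apply: (IH b1); apply: (mulfI (prime_polyC_neq0 px)).
  by rewrite mulrA -polyCM e eb mulrA [b1 * _]mulrC.
by move/pp => /(_ px).
Qed.

Hypothesis fA : factorial_domain A.

Lemma primitive_cancelp p a : primitive p -> p %| a -> divides p a.
Proof.
move=> pp /Pdiv.Idomain.dvdpP [[c q] /= c0 e].
by apply: (primitive_cancel (fA c0) pp (b := q)); rewrite mul_polyC.
Qed.

Lemma primitive_prime p : primitive p -> (1 < size p)%N ->
  (forall q r, p = q * r -> (size q <= 1)%N \/ (size r <= 1)%N) ->
  prime_elt p.
Proof.
move=> pp sp irr.
have p0 : p != 0 by rewrite -size_poly_eq0 -lt0n ltnW.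
split=> //; first by rewrite poly_unitE; case: eqP sp => // ->.
move=> a b dab; have dab' : p %| a * b.
  case: dab => c ->; exact: Pdiv.Idomain.dvdp_mull.
have /Pdiv.Idomain.dvdpP[[c h] /= c0 e] := Pdiv.Idomain.dvdp_gcdl p a.
set g := gcdp p a in e.
have [q' [r' [epq sh sg]]] : exists q' r',
    [/\ p = q' * r', size q' = size h & size r' = size g].
  by apply: (strip (fA c0)); rewrite mul_polyC.
have gh0 : h * g != 0 by rewrite -e scale_poly_eq0 negb_or c0.
have [h0 g0] : h != 0 /\ g != 0 by apply/andP; rewrite -negb_or -mulf_eq0.
have [s1|s1] := irr _ _ epq.
- left; apply: primitive_cancelp => //.
  have sh1 : size h = 1 by apply/eqP; rewrite eqn_leq -sh s1 sh size_poly_gt0.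
  have /eqP/size_poly1P[k k0 ek] := sh1.
  apply: (Pdiv.Idomain.dvdp_trans _ (Pdiv.Idomain.dvdp_gcdr p a)).
  rewrite -/g -(Pdiv.Idomain.dvdpZr _ _ k0) -mul_polyC -ek -e.
  by rewrite Pdiv.Idomain.dvdpZr.
- right; apply: primitive_cancelp => //.
  rewrite -(@Pdiv.Idomain.Gauss_dvdpr _ b a p) //.
  by rewrite /coprimep -/g eqn_leq -sg s1 sg size_poly_gt0.
Qed.

Lemma content_primitive p : p != 0 ->
  exists c q, [/\ c != 0, p = c%:P * q & primitive q].
Proof.
move=> p0.
have [a [a0 pa]] : exists a : A, a != 0 /\ forall c, divides c%:P p -> divides c a.
  exists (lead_coef p); split; first by rewrite lead_coef_eq0.
  by move=> c /divides_polyC; apply.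
elim: {a a0}(fA a0) p p0 pa => [u uU|x y px _ IH] p p0 pa.
  exists 1, p; split; rewrite ?oner_eq0 ?polyC1 ?mul1r // => a [_ aU _] /pa [c eu].
  by move: uU; rewrite eu unitrM (negPf aU) andbF.
have [x0 xU xd] := px.
case: (pselect (divides x%:P p)) => [[p' ep]|nd].
  have p'0 : p' != 0 by apply: contraNneq p0 => p'0; rewrite ep p'0 mul0r.
  have [c [q [c0 eq pq]]] : exists c q, [/\ c != 0, p' = c%:P * q & primitive q].
    apply: IH => // c [q eq].
    have [z ez] : divides (x * c) (x * y).
      by apply: pa; exists q; rewrite ep eq polyCM -mulrA [c%:P * _]mulrC.
    by exists z; apply: (mulfI x0); rewrite ez mulrCA.
  by exists (x * c), q; split; rewrite ?mulf_neq0 // ep eq mulrC polyCM mulrA.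
apply: IH => // c dc; have [k ek] := pa _ dc.
have [] := xd k c; first by exists y; rewrite -ek mulrC.
  by case=> z ez; exists z; apply: (mulfI x0); rewrite ek ez mulrA [x * z]mulrC.
case=> z ez; case: nd; case: dc => q ->; exists (q * z%:P).
by rewrite ez polyCM mulrA.
Qed.

Lemma factorial_poly : factorial_domain {poly A}.
Proof.
move=> p; have [n] := ubnP (size p); elim: n p => // n IH p /ltnSE sp p0.
have [c [q [c0 ep pq]]] := content_primitive p0.
have q0 : q != 0 by apply: contraNneq p0 => q0; rewrite ep q0 mulr0.
have sq : size q = size p by rewrite ep mul_polyC size_scale.
rewrite ep; apply: prime_prodM; first exact/prime_prod_polyC/fA.
have [s1|s1] := leqP (size q) 1.
  have /size_poly1P[k k0 ->] : size q == 1 by rewrite eqn_leq s1 size_poly_gt0.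
  exact/prime_prod_polyC/fA.
case: (pselect (exists r s, [/\ q = r * s, (1 < size r)%N & (1 < size s)%N])).
  case=> r [s [e sr ss]].
  have [r0 s0] : r != 0 /\ s != 0 by apply/andP; rewrite -negb_or -mulf_eq0 -e.
  have er : (size q = (size r + size s).-1)%N by rewrite e size_mul.
  rewrite e; apply: prime_prodM; apply: IH => //; apply: leq_trans sp.
    rewrite -sq er; case: (size s) ss => [|[|k]] // _.
    by rewrite !addnS /= ltnS leq_addr.
  rewrite -sq er; case: (size r) sr => [|[|k]] // _.
  by rewrite !addSn /= ltnS leq_addl.
move=> nrs; rewrite -[q]mulr1; constructor; last by constructor; exact: unitr1.
apply: primitive_prime => // r s e.
apply: contrapT => /not_orP[/negP hr /negP hs]; apply: nrs.
by exists r, s; rewrite !ltnNge.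
Qed.

End FactorialPoly.

Lemma factorial_iso (A B : idomainType) (phi : {rmorphism A -> B}) :
  injective phi -> (forall b, exists a, phi a = b) ->
  factorial_domain B -> factorial_domain A.
Proof.
move=> inj surj fB a a0.
have unitP x : phi x \is a GRing.unit -> x \is a GRing.unit.
  move=> xU; have [y ey] := surj (phi x)^-1.
  by apply/unitrP; exists y; split; apply: inj; rewrite rmorphM rmorph1 ey ?mulVr ?divrr.
have divE x y : divides x y <-> divides (phi x) (phi y).
  split=> [[c ->]|[c e]]; first by exists (phi c); rewrite rmorphM.
  by have [d ed] := surj c; exists d; apply: inj; rewrite rmorphM ed.
have primeP x : prime_elt (phi x) -> prime_elt x.
  move=> [x0 xU xd]; split.
  - by apply: contraNneq x0 => ->; rewrite rmorph0.
  - by apply: contra xU; exact: rmorph_unit.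
  - by move=> b c; rewrite !divE rmorphM; exact: xd.
have : prime_prod (phi a) by apply: fB; rewrite -(rmorph0 phi) (inj_eq inj).
move eb : (phi a) => b pb; elim: pb a eb {a0} => [u uU|p c pp _ IH] a ea.
  by constructor; apply: unitP; rewrite ea.
have [p' ep] := surj p; have [c' ec] := surj c.
have -> : a = p' * c' by apply: inj; rewrite rmorphM ep ec.
constructor; last exact: IH.
by apply: primeP; rewrite ep.
Qed.

Section FactorialMpoly.
Variable K : fieldType.

Section Multi.
Variable n : nat.

(* Two-sided inverse of muni. *)
Definition mmulti_eval (q : {poly {mpoly K[n]}}) : {mpoly K[n.+1]} :=
  (map_poly (@mwiden n K) q).['X_ord_max].

Lemma muni_mwiden (c : {mpoly K[n]}) : muni (mwiden c) = c%:P.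
Proof.
have mX m : mmap1 (fun i : 'I_n => 'X_(widen_ord (leqnSn n) i)) m
    = 'X_[mnmwiden m] :> {mpoly K[n.+1]} by rewrite -mwidenX /mwiden mmapX.
rewrite [in RHS](mpolyE c) /mwiden /mmap !raddf_sum /=; apply: eq_bigr => m _.
rewrite mul_mpolyC mX muniZ muniE msuppX big_seq1 mcoeffX eqxx scale1r.
rewrite mnmwiden_ordmax expr0 alg_polyC -mul_polyC -polyCM mul_mpolyC.
by congr (_ *: 'X_[_])%:P; apply/mnmP => i; rewrite mnmE mnmwiden_widen.
Qed.

Lemma muni_Xmax : muni ('X_ord_max : {mpoly K[n.+1]}) = 'X.
Proof.
rewrite muniE msuppX big_seq1 mcoeffX eqxx scale1r mnmE eqxx expr1.
rewrite (_ : [multinom _ | _ < n] = 0%MM) ?mpolyX0 ?scale1r //.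
apply/mnmP => i; rewrite !mnmE; case: eqP => // /(congr1 val) /= e.
by have := ltn_ord i; rewrite -e ltnn.
Qed.

Lemma mmulti_evalK (q : {poly {mpoly K[n]}}) : muni (mmulti_eval q) = q.
Proof.
elim/poly_ind: q => [|q c IH]; first by rewrite /mmulti_eval !raddf0 horner0 raddf0.
rewrite /mmulti_eval rmorphD rmorphM /= map_polyX map_polyC /= hornerMXaddC.
by rewrite muniD muniM IH muni_Xmax muni_mwiden.
Qed.

Lemma muniK (p : {mpoly K[n.+1]}) : mmulti_eval (muni p) = p.
Proof.
rewrite [in RHS](mpolyE p) muniE /mmulti_eval !raddf_sum /= horner_sum.
apply: eq_bigr => m _.
rewrite -mul_polyC rmorphM /= map_polyC map_polyXn /= hornerM hornerC hornerXn.
rewrite mwidenZ mwidenX -scalerAl; congr (_ *: _).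
rewrite [in RHS]mpolyXE_id [in LHS]mpolyXE_id !big_ord_recr /= mnmwiden_ordmax.
rewrite expr0 mulr1; congr (_ * _); apply: eq_bigr => i _.
by rewrite mnmwiden_widen mnmE.
Qed.

End Multi.

Lemma factorial_mpoly n : factorial_domain {mpoly K[n]}.
Proof.
elim: n => [|n IH].
  move=> p p0; constructor; rewrite unfold_in /= /mpoly_unit -nvar0_mpolyC eqxx /=.
  by rewrite unitfE -(mpolyC_eq0 0) -nvar0_mpolyC.
apply: (@factorial_iso _ _ (@muni n K)); last exact: factorial_poly.
  exact: can_inj (@muniK n).
by move=> b; exists (mmulti_eval b); exact: mmulti_evalK.
Qed.

End FactorialMpoly.

Section PrincipalQuotient.
Variables (A : idomainType) (f : A).

(* The ideal (f); the proof argument only serves to attach the prime ideal     *)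
(* structure, which the library's ring quotient needs.                         *)
Definition principal_ideal (pf : prime_elt f) : {pred A} :=
  fun a => `[< divides f a >].

Variable pf : prime_elt f.

Lemma principal_idealP a : reflect (divides f a) (a \in principal_ideal pf).
Proof. exact: asboolP. Qed.

Lemma principal_idealr_closed : idealr_closed (principal_ideal pf).
Proof.
split.
- by apply/principal_idealP; exists 0; rewrite mul0r.
- apply/principal_idealP => -[c e]; have [_ /negP fU _] := pf; apply: fU.
  by apply/unitrP; exists c; rewrite [f * c]mulrC -e.
- move=> a u v /principal_idealP[x ->] /principal_idealP[y ->].
  by apply/principal_idealP; exists (a * x + y); rewrite mulrDl mulrA.
Qed.

Lemma principal_prime_closed : prime_idealr_closed (principal_ideal pf).
Proof.
have [_ _ fd] := pf => u v /principal_idealP /fd h.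
by apply/orP; case: h => h; [left|right]; apply/principal_idealP.
Qed.

HB.instance Definition _ :=
  isIdealr.Build A (principal_ideal pf) principal_idealr_closed.
HB.instance Definition _ :=
  isPrimeIdealrClosed.Build A (principal_ideal pf) principal_prime_closed.

Definition principal_quot := {ideal_quot (principal_ideal pf)}.

HB.instance Definition _ := GRing.ComNzRing.on principal_quot.

(* An idomainType carries a unit predicate and an inverse, chosen classically. *)
Definition pquot_unit : {pred principal_quot} :=
  fun x => `[< exists y, y * x = 1 >].

Definition pquot_inv (x : principal_quot) : principal_quot :=
  if pselect (exists y, y * x = 1) is left h then projT1 (cid h) else x.

Lemma pquot_mulVx : {in pquot_unit, left_inverse 1 pquot_inv *%R}.
Proof.
move=> x /asboolP xU; rewrite /pquot_inv.
by case: pselect => // h; case: (cid h).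
Qed.

Lemma pquot_unitP x y : y * x = 1 -> x \in pquot_unit.
Proof. by move=> e; apply/asboolP; exists y. Qed.

Lemma pquot_inv_out : {in [predC pquot_unit], pquot_inv =1 id}.
Proof. by move=> x /asboolP nx; rewrite /pquot_inv; case: pselect. Qed.

HB.instance Definition _ := GRing.ComNzRing_hasMulInverse.Build principal_quot
  pquot_mulVx pquot_unitP pquot_inv_out.

Lemma pquot_integral : GRing.integral_domain_axiom principal_quot.
Proof. exact: (@Quotient.rquot_IdomainAxiom A (principal_ideal pf)). Qed.

HB.instance Definition _ :=
  GRing.ComUnitRing_isIntegral.Build principal_quot pquot_integral.

End PrincipalQuotient.

(* K[X_1,..,X_n]/(f) *)
Definition hypersurface_ring (K : fieldType) (n : nat) (f : {mpoly K[n]})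
    (f_irr : irreducible_elt f) : idomainType :=
  principal_quot (irreducible_prime (@factorial_mpoly K n) f_irr).

Section ReciprocalComplement.
Variable D : idomainType.

(* The intersection of all subrings of Q(D) containing every 1/x, x != 0. *)
Definition reciprocal_pred : {pred {fraction D}} := fun z =>
  `[< forall S : {pred {fraction D}}, subring_closed S ->
        (forall x : D, x != 0 -> (FracField.tofrac x)^-1 \in S) -> z \in S >].

Lemma reciprocal_predP z :
  reflect (forall S : {pred {fraction D}}, subring_closed S ->
             (forall x : D, x != 0 -> (FracField.tofrac x)^-1 \in S) -> z \in S)
          (z \in reciprocal_pred).
Proof. exact: asboolP. Qed.

Lemma reciprocal_subring_closed : subring_closed reciprocal_pred.
Proof.
split=> [|x y|x y].
- by apply/reciprocal_predP => S [].
- move=> /reciprocal_predP xS /reciprocal_predP yS.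
  apply/reciprocal_predP => S clS iS.
  by case: (clS) => _ SB _; apply: SB; [exact: xS | exact: yS].
- move=> /reciprocal_predP xS /reciprocal_predP yS.
  apply/reciprocal_predP => S clS iS.
  by case: (clS) => _ _ SM; apply: SM; [exact: xS | exact: yS].
Qed.

HB.instance Definition _ :=
  GRing.isSubringClosed.Build {fraction D} reciprocal_pred
    reciprocal_subring_closed.

Definition reciprocal_complement := {z : {fraction D} | z \in reciprocal_pred}.

HB.instance Definition _ := SubChoice.on reciprocal_complement.
HB.instance Definition _ :=
  [SubChoice_isSubComNzRing of reciprocal_complement by <:].

End ReciprocalComplement.

Section KrullDimension.
Variable R : comNzRingType.

(* idealr_closed includes 1 \notin P. *)
Definition prime_ideal (P : {pred R}) :=
  idealr_closed P /\ prime_idealr_closed P.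

(* P_0 < ... < P_n, a chain of length n. *)
Definition prime_chain (n : nat) (P : 'I_n.+1 -> {pred R}) :=
  (forall i, prime_ideal (P i)) /\
  (forall i j : 'I_n.+1, (i < j)%N ->
     {subset P i <= P j} /\ ~ {subset P j <= P i}).

Definition has_krull_dim (n : nat) :=
  (exists P, @prime_chain n P) /\ (forall m P, @prime_chain m P -> (m <= n)%N).

End KrullDimension.

(* Covers characteristic 0, since 0 %| n only for n = 0. *)
Definition has_characteristic (K : fieldType) (p : nat) :=
  forall n : nat, (n%:R == 0 :> K) = (p %| n)%N.

(* The inclusion of K[Y,Z] in K[X,Y,Z]; X, Y, Z are the variables of index     *)
(* 0, 1, 2, so the two variables of g are sent to those of index 1 and 2.      *)
Definition in_YZ (K : fieldType) (g : {mpoly K[2]}) : {mpoly K[3]} :=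
  g \mPo [tuple 'X_(inord 1); 'X_(inord 2)].

(* Main.v *)
From HB Require Import structures.
Require Import Defs.
From mathcomp Require Import all_boot all_algebra.
From mathcomp.classical Require Import boolp.
From mathcomp Require Import ring zify.
Set Implicit Arguments.
Unset Strict Implicit.
Unset Printing Implicit Defensive.

Import GRing.Theory.

Local Open Scope ring_scope.

(** Write X, Y, Z for the variables, D = K[X,Y,Z]/(f), and R for the
    reciprocal complement of D.

    Lower bound.  Grade K[X,Y,Z] by the degree in Y and Z alone.  Since the top
    form of f for the total degree is X^d + g(Y,Z), the top form of f for the
    grading by Y and Z is g.  As g is prime, the ring K[X,Y,Z]/(g) attached to
    the induced filtration of D is a domain, so minus the (Y,Z)-degree of a
    representative of least degree is a valuation w on Q(D).  It is never
    positive on nonzero elements of D, so R lies in its valuation ring, and D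
    has only the elements of K[X] in degree 0.  Hence every r in R can be
    written r = u + m, with w(m) > 0 and with u a rational function in K(X) of
    degree at most 0; this holds for the generators 1/h and is stable under
    the ring operations.  The conditions u = 0 and deg u < 0 define two
    primes P1 and P2 of R (they are the traces on R of the two nonzero primes
    of a valuation ring of rank 2), and 0 < P1 < P2 because 1/Y lies in P1 and
    1/X lies in P2 but not in P1.  This is [reciprocal_chain2].

    To handle representatives, the grading is encoded by the ring morphism
    phi : X, Y, Z |-> X, YT, ZT into K[X,Y,Z][T]: the (Y,Z)-degree of a is the
    T-degree of phi a, and its top form is the leading coefficient.  A
    polynomial has least degree modulo f as soon as g does not divide its top
    form ([reduced], [reduced_min]), and primality of g makes this condition
    multiplicative.

    Upper bound.  Any three elements of Q(D) are algebraically dependent over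
    K.  To see this without reducing modulo f, lift them to fractions of
    K[X,Y,Z]; counting monomials, the lifts and f satisfy a polynomial relation
    over K, whose lowest term in f gives a relation modulo f
    ([hypersurface_dependent]).  A relation between x in P1 \ P0, y in P2 \ P1
    and t in P3 \ P2, for primes P0 < P1 < P2 < P3 of R, is contradictory:
    by cancelling the power of x in its lowest term, one sees that a nonzero
    polynomial in y and t lies in P1; then one in t lies in P2; then
    a nonzero constant lies in P3.  Both arguments isolate a lowest term in the
    same way ([lowest_term_ideal]). *)

(** * The valuation at infinity attached to a grading *)

(** The morphism phi encodes a grading of A: if a is the sum of its components
    a_i of degree i, then phi a is the sum of the a_i T^i.  The hypotheses phi1
    and phi_coef say just that: a is the sum of the coefficients of phi a, and
    each of them is homogeneous. *)
Section Valuation.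
Variables (A : idomainType) (phi : {rmorphism A -> {poly A}}) (f : A).
Hypothesis phi1 : forall a, (phi a).[1] = a.
Hypothesis phi_coef : forall a i, phi (phi a)`_i = (phi a)`_i *: 'X^i.
Hypothesis lead_prime : prime_elt (lead_coef (phi f)).
Hypothesis size_f : (1 < size (phi f))%N.

(** The top form of b is nonzero in the quotient by the top form of f, which is
    the graded ring of A/(f); so b has least degree in its class modulo f. *)
Definition reduced (b : A) := ~ divides (lead_coef (phi f)) (lead_coef (phi b)).

Lemma phi_eq0 a : (phi a == 0) = (a == 0).
Proof.
by apply/eqP/eqP => [e|->]; rewrite ?rmorph0 // -[a]phi1 e horner0.
Qed.

Lemma reduced_neq0 b : reduced b -> b != 0.
Proof.
move=> rb; apply/negP => /eqP b0; apply: rb.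
by exists 0; rewrite b0 rmorph0 lead_coef0 mul0r.
Qed.

Lemma reducedM b c : reduced b -> reduced c -> reduced (b * c).
Proof.
rewrite /reduced => rb rc; rewrite rmorphM /= lead_coefM.
by have [_ _ h] := lead_prime; case/h.
Qed.

Lemma size_phiM a b : a != 0 -> b != 0 ->
  size (phi (a * b)) = (size (phi a) + size (phi b)).-1.
Proof. by move=> a0 b0; rewrite rmorphM size_mul ?phi_eq0. Qed.

Lemma phi_lead a :
  phi (lead_coef (phi a)) = lead_coef (phi a) *: 'X^((size (phi a)).-1).
Proof. by rewrite /lead_coef phi_coef. Qed.

Lemma f_neq0 : f != 0.
Proof. by rewrite -phi_eq0 -size_poly_gt0 ltnW. Qed.

(** If the top form of a is c times the top form of f, then c is homogeneous
    too, and subtracting c * f cancels the top form of a. *)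
Lemma drop_size a : ~ divides f a -> ~ reduced a ->
  exists c, (size (phi (a - c * f)%R) < size (phi a))%N.
Proof.
move=> fa /contrapT[c ec].
have a0 : a != 0.
  by apply/negP => /eqP a0; apply: fa; exists 0; rewrite a0 mul0r.
have pa0 : phi a != 0 by rewrite phi_eq0.
have pf0 : phi f != 0 by rewrite phi_eq0 f_neq0.
have [G0 _ _] := lead_prime.
have c0 : c != 0.
  apply: contraNneq pa0 => c0; rewrite -lead_coef_eq0 ec c0 mul0r //.
have e : phi c * 'X^((size (phi f)).-1) = c%:P * 'X^((size (phi a)).-1).
  apply: (mulIf (x := (lead_coef (phi f))%:P)); first by rewrite polyC_eq0.
  have := phi_lead a; rewrite ec rmorphM /= phi_lead => h.
  transitivity (phi c * (lead_coef (phi f) *: 'X^((size (phi f)).-1))).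
    by rewrite -mul_polyC; ring.
  by rewrite h -mul_polyC polyCM; ring.
exists c; rewrite rmorphB rmorphM /=.
(* Both sides of e have the same size, whence the degrees of c and f add up
   to that of a. *)
have le : ((size (phi f)).-1 <= (size (phi a)).-1)%N.
  have pc0 : phi c != 0 by rewrite phi_eq0.
  have := congr1 (fun r : {poly A} => size r) e.
  rewrite /= size_mulXn // mul_polyC size_scale // size_polyXn.
  move: pc0; rewrite -size_poly_gt0; case: (size (phi c)) => // k _; lia.
have e' : phi c = c%:P * 'X^((size (phi a)).-1 - (size (phi f)).-1).
  apply: (mulIf (x := 'X^((size (phi f)).-1))).
    by rewrite monic_neq0 ?monicXn.
  by rewrite e -mulrA -exprD subnK.
have pcf0 : phi c * phi f != 0 by rewrite mulf_neq0 ?phi_eq0 ?f_neq0.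
have sz : size (phi c * phi f) = size (phi a).
  rewrite size_mul ?phi_eq0 ?f_neq0 // e' mul_polyC size_scale // size_polyXn.
  move: pa0; rewrite -size_poly_gt0; case: (size (phi a)) le => // k le _.
  by move: size_f; case: (size (phi f)) le => // k' /= le _; lia.
have lt (r : {poly A}) : (size r <= size (phi a))%N -> r`_(size (phi a)).-1 = 0 ->
    (size r < size (phi a))%N.
  move=> sr r0; rewrite ltn_neqAle sr andbT; apply/negP => /eqP es.
  have : lead_coef r = 0 by rewrite /lead_coef es.
  move/eqP; rewrite lead_coef_eq0 => /eqP r00.
  by move: pa0; rewrite -size_poly_eq0 -es r00 size_poly0.
apply: lt.
  apply: leq_trans (size_polyD _ _) _.
  by rewrite size_polyN sz maxnn.
rewrite coefB -lead_coefE -[in X in _ - X]sz -lead_coefE lead_coefM ec.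
by rewrite e' mul_polyC lead_coefZ lead_coefXn mulr1 subrr.
Qed.

Variables (F : fieldType) (iota : {rmorphism A -> F}).
Hypothesis iota_ker : forall a, iota a = 0 <-> divides f a.

Lemma iota_f : iota f = 0.
Proof. by apply/iota_ker; exists 1; rewrite mul1r. Qed.

Lemma reduced_rep a : iota a != 0 -> exists2 b, reduced b & iota b = iota a.
Proof.
have [n] := ubnP (size (phi a)); elim: n a => // n IH a /ltnSE sa a0.
case: (pselect (reduced a)) => [ra|nra]; first by exists a.
have [|c hc] := drop_size _ nra; first by move/iota_ker/eqP; rewrite (negPf a0).
have e : iota (a - c * f) = iota a.
  by rewrite rmorphB rmorphM /= iota_f mulr0 subr0.
have [||b rb eb] := IH (a - c * f); [exact: leq_trans sa|by rewrite e|].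
by exists b => //; rewrite eb.
Qed.

(** A representative a of smaller degree would make b - a a multiple of f with
    the same top form as b. *)
Lemma reduced_min a b : reduced b -> iota a = iota b ->
  (size (phi b) <= size (phi a))%N.
Proof.
move=> rb eab; rewrite leqNgt; apply/negP => lt.
have /iota_ker[c ec] : iota (b - a) = 0 by rewrite rmorphB eab subrr.
apply: rb; exists (lead_coef (phi c)).
rewrite -lead_coefM -rmorphM -ec rmorphB /= lead_coefDl //.
by rewrite size_polyN.
Qed.

Lemma iota_reduced b : reduced b -> iota b != 0.
Proof.
move=> rb; apply/eqP => b0.
have := @reduced_min 0 b rb; rewrite !rmorph0 b0 size_poly0 leqn0.
move=> /(_ erefl); rewrite size_poly_eq0 phi_eq0.
by rewrite (negPf (reduced_neq0 rb)).
Qed.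

(** Homogeneous of degree 0. *)
Definition flat (a : A) := phi a = a%:P.

Lemma flatM a b : flat a -> flat b -> flat (a * b).
Proof. by rewrite /flat rmorphM polyCM => -> ->. Qed.

Lemma flatB a b : flat a -> flat b -> flat (a - b).
Proof. by rewrite /flat rmorphB polyCB => -> ->. Qed.

Lemma flat1 : flat 1.
Proof. by rewrite /flat rmorph1 polyC1. Qed.

Lemma flat_size a : (size (phi a) <= 1)%N -> flat a.
Proof.
by rewrite /flat => /size1_polyC e; rewrite {1}e -{2}[a]phi1 {2}e hornerC.
Qed.

Lemma size_flat a : flat a -> a != 0 -> size (phi a) = 1%N.
Proof. by move=> -> a0; rewrite size_polyC a0. Qed.

(** The top form of f has the degree of f, so it cannot divide a nonzero form of
    lower degree. *)
Lemma reduced_lt a : a != 0 -> (size (phi a) < size (phi f))%N -> reduced a.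
Proof.
move=> a0 lt [c ec].
have c0 : c != 0.
  by apply: contraNneq a0 => c0; rewrite -phi_eq0 -lead_coef_eq0 ec c0 mul0r.
have [G0 _ _] := lead_prime.
have size_lead x : x != 0 -> size (phi (lead_coef (phi x))) = size (phi x).
  move=> x0; rewrite phi_lead size_scale ?lead_coef_eq0 ?phi_eq0 //.
  by rewrite size_polyXn prednK // size_poly_gt0 phi_eq0.
have := size_lead a a0; rewrite ec size_phiM // size_lead ?f_neq0 // => e.
move: lt c0; rewrite -e -phi_eq0 -size_poly_gt0; lia.
Qed.

Lemma flat_reduced q : flat q -> q != 0 -> reduced q.
Proof. by move=> fq q0; apply: reduced_lt => //; rewrite size_flat. Qed.

(** Membership in the maximal ideal of the valuation ring of F in which
    iota b, for b reduced, has value minus the degree of b. *)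
Definition infinitesimal (z : F) := exists a b,
  [/\ reduced b, (size (phi a) < size (phi b))%N & z = iota a / iota b].

Lemma infinitesimal0 : infinitesimal 0.
Proof.
exists 0, 1; rewrite !rmorph0 mul0r size_poly0 rmorph1 size_poly1; split=> //.
by apply: flat_reduced; [exact: flat1 | exact: oner_neq0].
Qed.

Lemma infinitesimalMl p q z : flat p -> flat q -> q != 0 -> infinitesimal z ->
  infinitesimal (iota p / iota q * z).
Proof.
move=> fp fq q0 [a [b [rb sab ->]]].
have rq := flat_reduced fq q0.
exists (p * a), (q * b); split; first exact: reducedM.
  rewrite (size_phiM q0 (reduced_neq0 rb)) (size_flat fq q0) add1n /=.
  apply: leq_ltn_trans sab.
  by rewrite rmorphM fp mul_polyC size_scale_leq.
have := iota_reduced rb; have := iota_reduced rq.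
by rewrite !rmorphM => h1 h2; field; rewrite h1 h2.
Qed.

Lemma infinitesimalN z : infinitesimal z -> infinitesimal (- z).
Proof.
move=> [a [b [rb sab ->]]]; exists (- a), b; split=> //.
  by rewrite rmorphN size_polyN.
by rewrite rmorphN mulNr.
Qed.

Lemma size_phiM_lt (a b a' b' : A) : b != 0 -> b' != 0 ->
  (size (phi a) < size (phi b))%N -> (size (phi a') <= size (phi b'))%N ->
  (size (phi (a * a')%R) < size (phi (b * b')%R))%N.
Proof.
move=> b0 b'0 h h'; rewrite (size_phiM b0 b'0).
have := b0; have := b'0; rewrite -!phi_eq0 -!size_poly_gt0 => g' g.
have [->|a0] := eqVneq a 0; first by rewrite mul0r rmorph0 size_poly0; lia.
have [->|a'0] := eqVneq a' 0; first by rewrite mulr0 rmorph0 size_poly0; lia.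
rewrite (size_phiM a0 a'0); have := a0; have := a'0.
rewrite -!phi_eq0 -!size_poly_gt0; lia.
Qed.

Lemma infinitesimalD y z :
  infinitesimal y -> infinitesimal z -> infinitesimal (y + z).
Proof.
move=> [a [b [rb sab ->]]] [a' [b' [rb' sab' ->]]].
exists (a * b' + a' * b), (b * b'); split; first exact: reducedM.
  have b0 := reduced_neq0 rb; have b'0 := reduced_neq0 rb'.
  rewrite rmorphD; apply: leq_ltn_trans (size_polyD _ _) _; rewrite gtn_max.
  rewrite size_phiM_lt //= [b * b']mulrC size_phiM_lt //.
have := iota_reduced rb; have := iota_reduced rb'.
by rewrite rmorphD !rmorphM => h1 h2; field; rewrite h1 h2.
Qed.

Lemma infinitesimalM y z :
  infinitesimal y -> infinitesimal z -> infinitesimal (y * z).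
Proof.
move=> [a [b [rb sab ->]]] [a' [b' [rb' sab' ->]]].
exists (a * a'), (b * b'); split; first exact: reducedM.
  by apply: size_phiM_lt; rewrite ?reduced_neq0 // ltnW.
have := iota_reduced rb; have := iota_reduced rb'.
by rewrite !rmorphM => h1 h2; field; rewrite h1 h2.
Qed.

(** If p is nonzero, p / q = a / b makes p * b a reduced representative of
    q * a, although its degree is larger. *)
Lemma infinitesimal_flat p q : flat p -> flat q -> q != 0 ->
  infinitesimal (iota p / iota q) -> p = 0.
Proof.
move=> fp fq q0 [a [b [rb sab e]]].
apply/eqP; apply: contraT => p0.
have rp := flat_reduced fp p0; have rq := flat_reduced fq q0.
have e2 : iota (q * a) = iota (p * b).
  have := iota_reduced rb; have h := iota_reduced rq => h2.
  rewrite !rmorphM; apply: (mulIf (invr_neq0 h)); rewrite mulrAC.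
  rewrite divff // mul1r mulrAC e divfK //.
have := reduced_min (reducedM rp rb) e2.
rewrite leqNgt (size_phiM p0 (reduced_neq0 rb)) (size_flat fp p0) add1n /=.
by rewrite (leq_ltn_trans _ sab) // rmorphM fq mul_polyC size_scale_leq.
Qed.


(** The morphism theta supplies a second degree, used on flat elements only.
    With phi the grading by Y and Z, the flat elements form K[X], and theta
    measures the degree in X. *)
Variables (B : idomainType) (theta : {rmorphism A -> {poly B}}).
Hypothesis theta_eq0 : forall a, (theta a == 0) = (a == 0).

(** The fraction p / q represents the class of z in the residue field of the
    valuation; only classes in the subfield of flat fractions matter. *)
Definition residue (z : F) (p q : A) :=
  [/\ flat p, flat q, q != 0 & infinitesimal (z - iota p / iota q)].

Lemma residueB y z p q p' q' : residue y p q -> residue z p' q' ->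
  residue (y - z) (p * q' - p' * q) (q * q').
Proof.
move=> [fp fq q0 hy] [fp' fq' q'0 hz]; split; rewrite ?mulf_neq0 //.
- by apply: flatB; apply: flatM.
- exact: flatM.
have := iota_reduced (flat_reduced fq q0).
have := iota_reduced (flat_reduced fq' q'0) => h' h.
have -> : y - z - iota (p * q' - p' * q) / iota (q * q') =
    (y - iota p / iota q) + - (z - iota p' / iota q').
  by rewrite rmorphB !rmorphM; field; rewrite h h'.
by apply: infinitesimalD => //; exact: infinitesimalN.
Qed.

Lemma residueM y z p q p' q' : residue y p q -> residue z p' q' ->
  residue (y * z) (p * p') (q * q').
Proof.
move=> [fp fq q0 hy] [fp' fq' q'0 hz]; split; rewrite ?mulf_neq0 //;
  try exact: flatM.
have := iota_reduced (flat_reduced fq q0).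
have := iota_reduced (flat_reduced fq' q'0) => h' h.
have -> : y * z - iota (p * p') / iota (q * q') =
    (y - iota p / iota q) * (z - iota p' / iota q') +
    (iota p / iota q * (z - iota p' / iota q') +
     iota p' / iota q' * (y - iota p / iota q)).
  by rewrite !rmorphM; field; rewrite h h'.
apply: infinitesimalD; first exact: infinitesimalM.
by apply: infinitesimalD; apply: infinitesimalMl.
Qed.

(** A nonzero flat fraction is not infinitesimal, so the flat fractions embed in
    the residue field. *)
Lemma residue_uniq z p q p' q' : residue z p q -> residue z p' q' ->
  p * q' = p' * q.
Proof.
move=> r r'; have [fn fd d0] := residueB r r'.
rewrite subrr sub0r => /infinitesimalN; rewrite opprK => h.
by apply/eqP; rewrite -subr_eq0; apply/eqP; apply: infinitesimal_flat h.
Qed.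

Lemma residue_frac p q : flat p -> flat q -> q != 0 ->
  residue (iota p / iota q) p q.
Proof. by move=> *; split=> //; rewrite subrr; exact: infinitesimal0. Qed.

Lemma residue0P z : residue z 0 1 <-> infinitesimal z.
Proof.
rewrite /residue rmorph0 mul0r subr0; split=> [[]//|h]; split=> //.
- by rewrite /flat rmorph0 polyC0.
- exact: flat1.
- exact: oner_neq0.
Qed.

Lemma residue_infinitesimal z p q : residue z p q -> infinitesimal z -> p = 0.
Proof.
by move=> r /residue0P/(residue_uniq r); rewrite mulr1 mul0r.
Qed.

Lemma residue0_infinitesimal z q : residue z 0 q -> infinitesimal z.
Proof. by case=> _ _ _; rewrite rmorph0 mul0r subr0. Qed.

(** The pullback, along the residue map, of the ring of flat fractions of
    nonpositive degree; [small] is the pullback of its maximal ideal. *)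
Definition bounded z :=
  exists p q, residue z p q /\ (size (theta p) <= size (theta q))%N.

Definition small z :=
  exists p q, residue z p q /\ (size (theta p) < size (theta q))%N.

Lemma infinitesimal_small z : infinitesimal z -> small z.
Proof.
move/residue0P => h; exists 0, 1; split=> //.
by rewrite rmorph0 rmorph1 size_poly0 size_poly1.
Qed.

Lemma small_bounded z : small z -> bounded z.
Proof. by move=> [p [q [r h]]]; exists p, q; split=> //; exact: ltnW. Qed.

Lemma bounded1 : bounded 1.
Proof.
exists 1, 1; split=> //; rewrite -[X in residue X](divr1 1) -(rmorph1 iota).
by apply: residue_frac; [exact: flat1 | exact: flat1 | exact: oner_neq0].
Qed.

Lemma small1 : ~ small 1.
Proof.
move=> [p [q [r h]]].
have r1 : residue 1 1 1.
  rewrite -[X in residue X](divr1 1) -(rmorph1 iota).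
  by apply: residue_frac; [exact: flat1 | exact: flat1 | exact: oner_neq0].
by move: h; have := residue_uniq r r1; rewrite mulr1 mul1r => ->; rewrite ltnn.
Qed.

Lemma size_thetaM p q : p != 0 -> q != 0 ->
  size (theta (p * q)%R) = (size (theta p) + size (theta q)).-1.
Proof. by move=> p0 q0; rewrite rmorphM size_mul ?theta_eq0. Qed.

Lemma size_theta_gt0 q : (0 < size (theta q))%N = (q != 0).
Proof. by rewrite size_poly_gt0 theta_eq0. Qed.

Lemma size_thetaM_le (p q p' q' : A) : q != 0 -> q' != 0 ->
  (size (theta p) <= size (theta q))%N ->
  (size (theta p') <= size (theta q'))%N ->
  (size (theta (p * p')%R) <= size (theta (q * q')%R))%N.
Proof.
move=> q0 q'0 h h'; rewrite (size_thetaM q0 q'0).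
have [->|p0] := eqVneq p 0; first by rewrite mul0r rmorph0 size_poly0; lia.
have [->|p'0] := eqVneq p' 0; first by rewrite mulr0 rmorph0 size_poly0; lia.
by rewrite size_thetaM //; lia.
Qed.

Lemma size_thetaM_lt (p q p' q' : A) : q != 0 -> q' != 0 ->
  (size (theta p) <= size (theta q))%N ->
  (size (theta p') < size (theta q'))%N ->
  (size (theta (p * p')%R) < size (theta (q * q')%R))%N.
Proof.
move=> q0 q'0 h h'; rewrite (size_thetaM q0 q'0).
have := q0; have := q'0; rewrite -!size_theta_gt0 => g' g.
have [->|p0] := eqVneq p 0; first by rewrite mul0r rmorph0 size_poly0; lia.
have [->|p'0] := eqVneq p' 0; first by rewrite mulr0 rmorph0 size_poly0; lia.
have := p0; have := p'0; rewrite -!size_theta_gt0 => k' k.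
by rewrite size_thetaM //; lia.
Qed.

Lemma boundedB y z : bounded y -> bounded z -> bounded (y - z).
Proof.
move=> [p [q [r h]]] [p' [q' [r' h']]].
exists (p * q' - p' * q), (q * q'); split; first exact: residueB.
have [_ _ q0 _] := r; have [_ _ q'0 _] := r'.
rewrite rmorphB; apply: leq_trans (size_polyD _ _) _.
rewrite size_polyN geq_max size_thetaM_le //= [q * q']mulrC.
exact: size_thetaM_le.
Qed.

Lemma boundedM y z : bounded y -> bounded z -> bounded (y * z).
Proof.
move=> [p [q [r h]]] [p' [q' [r' h']]].
exists (p * p'), (q * q'); split; first exact: residueM.
by have [_ _ q0 _] := r; have [_ _ q'0 _] := r'; apply: size_thetaM_le.
Qed.

Lemma small_mull y z : bounded y -> small z -> small (y * z).
Proof.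
move=> [p [q [r h]]] [p' [q' [r' h']]].
exists (p * p'), (q * q'); split; first exact: residueM.
by have [_ _ q0 _] := r; have [_ _ q'0 _] := r'; apply: size_thetaM_lt.
Qed.

Lemma smallB y z : small y -> small z -> small (y - z).
Proof.
move=> [p [q [r h]]] [p' [q' [r' h']]].
exists (p * q' - p' * q), (q * q'); split; first exact: residueB.
have [_ _ q0 _] := r; have [_ _ q'0 _] := r'.
rewrite rmorphB; apply: leq_ltn_trans (size_polyD _ _) _.
rewrite size_polyN gtn_max [p * q']mulrC [q * q']mulrC size_thetaM_lt //=.
by rewrite [p' * q]mulrC [q' * q]mulrC size_thetaM_lt.
Qed.

(** If neither y nor z is small, their residues have degree 0, and so does the
    residue of y * z. *)
Lemma small_prime y z : bounded y -> bounded z -> small (y * z) ->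
  small y \/ small z.
Proof.
move=> [p [q [r h]]] [p' [q' [r' h']]] [p2 [q2 [r2 h2]]].
have [lt|ge] := ltnP (size (theta p)) (size (theta q)).
  by left; exists p, q.
have [lt|ge'] := ltnP (size (theta p')) (size (theta q')).
  by right; exists p', q'.
have [_ _ q0 _] := r; have [_ _ q'0 _] := r'; have [_ _ q20 _] := r2.
have e := residue_uniq r2 (residueM r r').
have p0 : p != 0 by rewrite -size_theta_gt0 (leq_trans _ ge) // size_theta_gt0.
have p'0 : p' != 0.
  by rewrite -size_theta_gt0 (leq_trans _ ge') // size_theta_gt0.
have p20 : p2 != 0.
  apply/negP => /eqP p20; move/eqP: e; rewrite p20 mul0r eq_sym.
  by rewrite !mulf_eq0 (negPf p0) (negPf p'0) (negPf q20).
have := congr1 (fun x => size (theta x)) e.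
rewrite /= !size_thetaM ?mulf_neq0 //.
by move: p0 p'0 q0 q'0 p20 q20; rewrite -!size_theta_gt0; lia.
Qed.

Lemma infinitesimal_mull y z :
  bounded y -> infinitesimal z -> infinitesimal (y * z).
Proof.
move=> [p [q [r h]]] /residue0P r'.
by move: (residueM r r'); rewrite mulr0; exact: residue0_infinitesimal.
Qed.

Lemma infinitesimal_prime y z : bounded y -> bounded z ->
  infinitesimal (y * z) -> infinitesimal y \/ infinitesimal z.
Proof.
move=> [p [q [r h]]] [p' [q' [r' h']]] /(residue_infinitesimal (residueM r r')).
move/eqP; rewrite mulf_eq0; case/orP => /eqP e; [left|right].
- by move: r; rewrite e; exact: residue0_infinitesimal.
- by move: r'; rewrite e; exact: residue0_infinitesimal.
Qed.

(** A reduced representative of degree 0 is flat, so its inverse is a flat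
    fraction of nonpositive degree; otherwise the inverse is infinitesimal. *)
Lemma bounded_inv a : iota a != 0 -> bounded (iota a)^-1.
Proof.
move=> /reduced_rep[b rb <-].
have [le|lt] := leqP (size (phi b)) 1.
  have fb := flat_size le; exists 1, b; split.
    rewrite -[_^-1]mul1r -(rmorph1 iota); apply: residue_frac => //.
      exact: flat1.
    exact: reduced_neq0.
  by rewrite rmorph1 size_poly1 size_theta_gt0 reduced_neq0.
apply: small_bounded; apply: infinitesimal_small.
by exists 1, b; rewrite !rmorph1 size_poly1 mul1r.
Qed.

Lemma flat_not_infinitesimal a :
  flat a -> a != 0 -> ~ infinitesimal (iota a)^-1.
Proof.
move=> fa a0; rewrite -[_^-1]mul1r -(rmorph1 iota).
move/(infinitesimal_flat (flat1) fa a0)/eqP.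
by rewrite oner_eq0.
Qed.

Lemma small_flat_inv a : flat a -> (1 < size (theta a))%N -> small (iota a)^-1.
Proof.
move=> fa sa; exists 1, a; rewrite rmorph1 size_poly1; split=> //.
rewrite -[_^-1]mul1r -(rmorph1 iota); apply: residue_frac => //.
  exact: flat1.
by rewrite -size_theta_gt0 ltnW.
Qed.

Lemma infinitesimal_inv a : reduced a -> (1 < size (phi a))%N ->
  infinitesimal (iota a)^-1.
Proof. by move=> ra sa; exists 1, a; rewrite !rmorph1 size_poly1 mul1r. Qed.

End Valuation.
(** * The reciprocal complement of a quotient by a prime element *)

Section QuotientFraction.
Variables (A : idomainType) (f : A) (pf : prime_elt f).
Local Notation D := (principal_quot pf).

Definition quot_frac (a : A) : {fraction D} := @FracField.tofrac D (\pi_D a)%qT.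

Fact quot_frac_is_zmod_morphism : zmod_morphism quot_frac.
Proof. by move=> a b; rewrite /quot_frac !rmorphB. Qed.

Fact quot_frac_is_monoid_morphism : monoid_morphism quot_frac.
Proof. by rewrite /quot_frac; split=> [|a b]; rewrite ?rmorph1 ?rmorphM. Qed.

HB.instance Definition _ := GRing.isZmodMorphism.Build _ _ quot_frac
  quot_frac_is_zmod_morphism.
HB.instance Definition _ := GRing.isMonoidMorphism.Build _ _ quot_frac
  quot_frac_is_monoid_morphism.

Lemma quot_frac_ker a : quot_frac a = 0 <-> divides f a.
Proof.
rewrite /quot_frac; split.
  move/eqP; rewrite tofrac_eq0 piE Quotient.equivE subr0.
  by move/principal_idealP.
move=> h; apply/eqP; rewrite tofrac_eq0 piE Quotient.equivE subr0.
exact/principal_idealP.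
Qed.

Lemma fractionE (B : idomainType) (z : {fraction B}) :
  exists a b, b != 0 /\ z = FracField.tofrac a / FracField.tofrac b.
Proof.
elim/quotW: z => r; exists (\n_r), (\d_r); split; first exact: denom_ratioP.
have nd : FracField.tofrac (\d_r) != 0 :> {fraction B}.
  by rewrite tofrac_eq0 denom_ratioP.
apply: (mulIf nd); rewrite divfK //; unlock FracField.tofrac.
rewrite -[LHS]FracField.pi_mul; apply/eqmodP; rewrite /= FracField.equivfE.
by rewrite !numden_Ratio ?mulr1 ?mul1r ?oner_eq0 ?denom_ratioP // mulrC.
Qed.

Lemma quot_fracE (z : {fraction D}) :
  exists a b, quot_frac b != 0 /\ z = quot_frac a / quot_frac b.
Proof.
have [x [y [y0 ->]]] := fractionE z; exists (repr x), (repr y).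
by rewrite /quot_frac !reprK tofrac_eq0.
Qed.

Lemma quot_frac_inv_in a : quot_frac a != 0 ->
  (quot_frac a)^-1 \in @reciprocal_pred D.
Proof.
move=> a0; apply/reciprocal_predP => S _; apply.
by apply: contraNneq a0 => e; rewrite /quot_frac e rmorph0.
Qed.

(** Induction over the subring generated by inverses, phrased with
    representatives in A. *)
Lemma reciprocal_ind (Q : {fraction D} -> Prop) :
  Q 1 -> (forall y z, Q y -> Q z -> Q (y - z)) ->
  (forall y z, Q y -> Q z -> Q (y * z)) ->
  (forall a, quot_frac a != 0 -> Q (quot_frac a)^-1) ->
  forall z, z \in @reciprocal_pred D -> Q z.
Proof.
move=> Q1 QB QM Qi z /reciprocal_predP/(_ (fun z => `[< Q z >])) zQ.
suff /asboolP : z \in (fun z => `[< Q z >] : bool) by [].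
apply: zQ => [|x x0].
  split; first exact/asboolP.
  - by move=> y t /asboolP Qy /asboolP Qt; apply/asboolP; exact: QB.
  - by move=> y t /asboolP Qy /asboolP Qt; apply/asboolP; exact: QM.
have e : quot_frac (repr x) = FracField.tofrac x by rewrite /quot_frac reprK.
by apply/asboolP; rewrite -e; apply: Qi; rewrite e tofrac_eq0.
Qed.

(** Primes of the reciprocal complement are given below as traces of subsets of
    the fraction field that are ideals only relative to it. *)
Lemma reciprocal_prime (Q : {fraction D} -> Prop) :
  Q 0 -> ~ Q 1 -> (forall y z, Q y -> Q z -> Q (y - z)) ->
  {in @reciprocal_pred D, forall y z, Q z -> Q (y * z)} ->
  {in @reciprocal_pred D &, forall y z, Q (y * z) -> Q y \/ Q z} ->
  prime_ideal (fun x : reciprocal_complement D => `[< Q (val x) >]).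
Proof.
move=> Q0 Q1 QB QM Qp; split.
  split; [exact/asboolP | exact/asboolPn |].
  move=> a u v /asboolP Qu /asboolP Qv; apply/asboolP.
  have -> : val (a * u + v) = val a * val u - (0 - val v).
    by rewrite sub0r opprK.
  apply: (QB); last exact: QB.
  by apply: QM => //; exact: (valP a).
move=> u v /asboolP Quv; apply/orP.
have [|Qu|Qv] := Qp (val u) (val v) (valP u) (valP v); first exact: Quv.
  by left; apply/asboolP.
by right; apply/asboolP.
Qed.
End QuotientFraction.

(** The chain consists of 0, the infinitesimal elements and the small elements;
    the inverse of y separates the first two, the inverse of x the last two. *)
Lemma reciprocal_chain2 (A B : idomainType) (f x y : A) (pf : prime_elt f)
    (phi : {rmorphism A -> {poly A}}) (theta : {rmorphism A -> {poly B}}) :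
  (forall a, (phi a).[1] = a) ->
  (forall a i, phi (phi a)`_i = (phi a)`_i *: 'X^i) ->
  prime_elt (lead_coef (phi f)) ->
  (forall a, (theta a == 0) = (a == 0)) ->
  flat phi x -> (1 < size (theta x))%N ->
  (1 < size (phi y) < size (phi f))%N ->
  exists P, @prime_chain (reciprocal_complement (principal_quot pf)) 2 P.
Proof.
move=> phi1 phi_coef lead_prime theta0 flatx sx /andP[sy lt].
have size_f := ltn_trans sy lt.
set D := principal_quot pf.
pose iota : {rmorphism A -> {fraction D}} := quot_frac pf.
have ker : forall a, iota a = 0 <-> divides f a by exact: quot_frac_ker.
pose inf := infinitesimal phi f iota.
pose sm := small phi f iota theta.
have bd z : z \in @reciprocal_pred D -> bounded phi f iota theta z.
  move: z; apply: reciprocal_ind.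
  - by apply: bounded1.
  - by move=> a b; apply: boundedB.
  - by move=> a b; apply: boundedM.
  - by move=> a; apply: bounded_inv.
have p0 : prime_ideal (fun x : reciprocal_complement D => `[< val x = 0 >]).
  apply: (reciprocal_prime (Q := fun z => z = 0)) => //.
  - exact/eqP/oner_neq0.
  - by move=> a b -> ->; rewrite subrr.
  - by move=> a _ b ->; rewrite mulr0.
  - by move=> a b _ _ /eqP; rewrite mulf_eq0 => /orP[] /eqP; [left|right].
have p1 : prime_ideal (fun x : reciprocal_complement D => `[< inf (val x) >]).
  apply: reciprocal_prime.
  - exact: infinitesimal0.
  - move=> h; have : small phi f iota theta 1 by apply: infinitesimal_small.
    by apply: small1.
  - move=> a b ha hb; apply: infinitesimalD => //; exact: infinitesimalN.
  - by move=> a ha b; apply: infinitesimal_mull (bd _ ha).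
  - by move=> a b ha hb; apply: infinitesimal_prime (bd _ ha) (bd _ hb).
have p2 : prime_ideal (fun x : reciprocal_complement D => `[< sm (val x) >]).
  apply: reciprocal_prime.
  - exact/infinitesimal_small/infinitesimal0.
  - exact: small1.
  - by move=> a b; apply: smallB.
  - by move=> a ha b; apply: small_mull (bd _ ha).
  - by move=> a b ha hb; apply: small_prime (bd _ ha) (bd _ hb).
have x0 : x != 0 by rewrite -theta0 -size_poly_gt0 ltnW.
have y0 : y != 0 by rewrite -(phi_eq0 phi1) -size_poly_gt0 ltnW.
have ry : reduced phi f y by apply: reduced_lt.
have ix : iota x != 0.
  by apply: (iota_reduced phi1) => //; apply: flat_reduced.
have iy : iota y != 0 by apply: (iota_reduced phi1).
pose u : reciprocal_complement D := exist _ (iota x)^-1 (quot_frac_inv_in ix).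
pose v : reciprocal_complement D := exist _ (iota y)^-1 (quot_frac_inv_in iy).
pose Q0 (u : reciprocal_complement D) := `[< val u = 0 >].
pose Q1 (u : reciprocal_complement D) := `[< inf (val u) >].
pose Q2 (u : reciprocal_complement D) := `[< sm (val u) >].
have s01 : {subset Q0 <= Q1}.
  by move=> z /asboolP z0; apply/asboolP; rewrite z0; apply: infinitesimal0.
have s12 : {subset Q1 <= Q2}.
  by move=> z /asboolP h; apply/asboolP; apply: infinitesimal_small.
have v0 : v \notin Q0 by apply/asboolPn/eqP; rewrite /= invr_eq0.
have v1 : v \in Q1 by apply/asboolP; apply: infinitesimal_inv.
have u1 : u \notin Q1 by apply/asboolPn; apply: flat_not_infinitesimal.
have u2 : u \in Q2 by apply/asboolP; apply: small_flat_inv.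
exists (fun i : 'I_3 => nth Q2 [:: Q0; Q1] i); split.
  by case=> [[|[|[|//]]] lti].
have strict (S S' : {pred reciprocal_complement D}) z : z \notin S -> z \in S' ->
    ~ {subset S' <= S}.
  by move=> zS zS' sub; move: zS; rewrite sub.
case=> [[|[|[|//]]] lti] [[|[|[|//]]] ltj] //= _; split=> //.
- exact: strict v0 v1.
- by move=> z /s01/s12.
- by apply: strict v0 _; exact: s12.
- exact: strict u1 u2.
Qed.

(** * Algebraic dependence and chains of primes *)

(** There are fewer than M^n monomials of degree less than M, so the matrix of
    coefficients of the h t has a nonzero left kernel. *)
Lemma exists_linear_relation (K : fieldType) (n M : nat) (T : finType)
    (h : T -> {mpoly K[n]}) :
  (forall t, (msize (h t) <= M)%N) -> (M ^ n < #|T|)%N ->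
  exists c : T -> K, (exists t, c t != 0) /\ \sum_t c t *: h t = 0.
Proof.
move=> sh lt; pose S := {ffun 'I_n -> 'I_M}.
pose mon (s : S) : 'X_{1..n} := [multinom (s i : nat) | i < n].
pose B := \matrix_(i < #|T|, j < #|S|) (h (enum_val i))@_(mon (enum_val j)).
have : kermx B != 0.
  rewrite kermx_eq0; apply/negP => rf.
  have := rank_leq_col B; rewrite (eqP rf) leqNgt card_ffun !card_ord.
  by rewrite lt.
rewrite -nz_row_eq0; set u := nz_row _ => u0.
have uB : u *m B = 0 by apply/sub_kermxP; exact: nz_row_sub.
exists (fun t => u 0 (enum_rank t)); split.
  have [i ui] : exists i, u 0 i != 0.
    by apply/rV0Pn; exact: u0.
  by exists (enum_val i); rewrite enum_valK.
apply/mpolyP => m; rewrite mcoeff0 raddf_sum /=.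
have [big|small] := leqP M (mdeg m).
  apply: big1 => t _; rewrite mcoeffZ (_ : (h t)@_m = 0) ?mulr0 //.
  by apply/eqP; rewrite mcoeff_eq0 msize_mdeg_ge // (leq_trans (sh t)).
have mlt (i : 'I_n) : (m i < M)%N.
  by rewrite (leq_ltn_trans _ small) // mdegE (bigD1 i) //= leq_addr.
pose s : S := [ffun i => Ordinal (mlt i)].
have es : mon s = m by apply/mnmP => i; rewrite mnmE ffunE.
have := congr1 (fun v : 'rV_#|S| => v 0 (enum_rank s)) uB.
rewrite /= !mxE => e; rewrite -[RHS]e (reindex _ (onW_bij _ (enum_val_bij T))) /=.
by apply: eq_bigr => i _; rewrite mcoeffZ enum_valK mxE enum_rankK es.
Qed.

(** Take the least i with z i false, factor x^i out of the sum, and cancel it,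
    as x is not in the prime P: what remains is s i plus a multiple of x, and
    both this sum and x lie in P'.  The predicate z marks the terms that vanish
    for formal reasons; the conclusion finds a coefficient that is not formally
    zero, although it may happen to be 0 in R. *)
Lemma lowest_term_ideal (R : comNzRingType) (P P' : {pred R}) (x : R) (n : nat)
    (s : 'I_n -> R) (z : pred 'I_n) :
  prime_ideal P -> idealr_closed P' -> {subset P <= P'} -> x \notin P ->
  x \in P' -> (forall i, z i -> s i = 0) -> (exists i, ~~ z i) ->
  \sum_i s i * x ^+ i \in P -> exists2 i, ~~ z i & s i \in P'.
Proof.
move=> [[P0 P1 Pl] Pp] [P'0 P'1 P'l] sub xP xP' zs [i0 zi0].
case: (@arg_minnP _ i0 (fun i => ~~ z i) val zi0) => j zj jmin sP; exists j => //.
pose r := \sum_(i < n | i != j) s i * x ^+ (i - j.+1).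
have e : \sum_i s i * x ^+ i = x ^+ j * (s j + x * r).
  rewrite (bigD1 j) //= mulrDr mulrC mulr_sumr mulr_sumr; congr (_ + _).
  apply: eq_bigr => i nij; have [zi|zi] := boolP (z i).
    by rewrite zs // !mul0r !mulr0.
  have lt : (j < i)%N by rewrite ltn_neqAle jmin // eq_sym andbT -val_eqE in nij *.
  have -> : x ^+ i = x ^+ j * (x * x ^+ (i - j.+1)).
    by rewrite -exprS -exprD subnSK // subnKC // ltnW.
  by rewrite mulrCA [s i * (x * _)]mulrCA.
have xj : x ^+ j \notin P.
  elim: (j : nat) => [|k IH]; rewrite ?expr0 ?exprS //.
  by apply/negP => /Pp/orP; case; apply/negP.
move: sP; rewrite e => /Pp; rewrite (negPf xj) /= => /sub h.
rewrite (_ : s j = - r * x + (s j + x * r)); first exact: P'l.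
ring.
Qed.

(** The function kappa stands for the structural morphism of a K-algebra. *)
Section Bound.
Variables (K : fieldType) (R : comNzRingType) (kappa : K -> R).
Hypothesis kappa0 : kappa 0 = 0.
Hypothesis kappa_unit : forall c, c != 0 -> exists u, u * kappa c = 1.
Hypothesis dependent : forall x y t : R,
  exists N (c : 'I_N -> 'I_N -> 'I_N -> K),
  (exists i j k, c i j k != 0) /\
  \sum_i (\sum_j (\sum_k kappa (c i j k) * t ^+ k) * y ^+ j) * x ^+ i = 0.

(** Each application of [lowest_term_ideal] removes one variable from the
    relation, until a unit kappa c would lie in P3. *)
Lemma no_prime_chain3 (P0 P1 P2 P3 : {pred R}) (x y t : R) :
  prime_ideal P0 -> prime_ideal P1 -> prime_ideal P2 -> prime_ideal P3 ->
  {subset P0 <= P1} -> {subset P1 <= P2} -> {subset P2 <= P3} ->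
  x \notin P0 -> x \in P1 -> y \notin P1 -> y \in P2 ->
  t \notin P2 -> t \in P3 -> False.
Proof.
move=> p0 p1 p2 p3 s01 s12 s23 x0 x1 y1 y2 t2 t3.
have [N [c [[i [j [k cn0]]] e]]] := dependent x y t.
have e0 : \sum_i (\sum_j (\sum_k kappa (c i j k) * t ^+ k) * y ^+ j) * x ^+ i
    \in P0 by rewrite e; have [] := p0.1.
have [||i' /forallPn[j' /forallPn[k' cn1]] P1i] :=
  @lowest_term_ideal R P0 P1 x N _ (fun i => [forall j, forall k, c i j k == 0])
    p0 p1.1 s01 x0 x1 _ _ e0.
- move=> i0 /forallP h; apply: big1 => j' _; rewrite big1 ?mul0r // => k' _.
  by have /forallP/(_ k')/eqP -> := h j'; rewrite kappa0 mul0r.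
- by exists i; apply/forallPn; exists j; apply/forallPn; exists k.
have [||j2 /forallPn[k2 cn2] P2j] :=
  @lowest_term_ideal R P1 P2 y N _ (fun j => [forall k, c i' j k == 0])
    p1 p2.1 s12 y1 y2 _ _ P1i.
- by move=> j0 /forallP h; apply: big1 => k2 _; rewrite (eqP (h k2)) kappa0 mul0r.
- by exists j'; apply/forallPn; exists k'.
have [||k3 cn3 P3k] :=
  @lowest_term_ideal R P2 P3 t N _ (fun k => c i' j2 k == 0)
    p2 p3.1 s23 t2 t3 _ _ P2j.
- by move=> k0 /eqP ->; rewrite kappa0.
- by exists k2.
have [P30 P31 P3l] := p3.1; have [u eu] := kappa_unit cn3.
by move: P31; rewrite -eu -[_ * _]addr0 P3l.
Qed.

Lemma prime_chain_le2 m (P : 'I_m.+1 -> {pred R}) : prime_chain P -> (m <= 2)%N.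
Proof.
move=> [pP cP]; rewrite leqNgt; apply/negP => m3.
pose o k := inord k : 'I_m.+1.
have step i j : (i < j <= 3)%N ->
    {subset P (o i) <= P (o j)} /\ exists2 x, x \notin P (o i) & x \in P (o j).
  case/andP=> ij j3; have [|sub nsub] := cP (o i) (o j).
    by rewrite !inordK //; lia.
  split=> //; apply: contrapT => nex; apply: nsub => x xj.
  by apply: contrapT => /negP xi; apply: nex; exists x.
have [s01 [x x0 x1]] := step 0 1 isT.
have [s12 [y y1 y2]] := step 1 2 isT.
have [s23 [t t2 t3]] := step 2 3 isT.
exact: (@no_prime_chain3 (P (o 0)) (P (o 1)) (P (o 2)) (P (o 3)) x y t).
Qed.

End Bound.

Lemma msizeM_bound (K : fieldType) n (p q : {mpoly K[n]}) i j :
  (msize p <= i.+1)%N -> (msize q <= j.+1)%N ->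
  (msize (p * q)%R <= (i + j).+1)%N.
Proof.
have [->|p0] := eqVneq p 0; first by rewrite mul0r msize0.
have [->|q0] := eqVneq q 0; first by rewrite mulr0 msize0.
by rewrite msizeM //; move: (msize p) (msize q) => a b; lia.
Qed.

Lemma msizeX_bound (K : fieldType) n (p : {mpoly K[n]}) i k :
  (msize p <= i.+1)%N -> (msize (p ^+ k)%R <= (k * i).+1)%N.
Proof.
move=> sp; elim: k => [|k IH]; first by rewrite expr0 msize1.
by rewrite exprS mulSn; exact: msizeM_bound.
Qed.

Lemma prime_ideal0 (R : idomainType) : prime_ideal (pred1 (0 : R)).
Proof.
split; last by move=> u v; rewrite !inE mulf_eq0.
split; rewrite ?inE ?eqxx ?oner_eq0 // => a u v; rewrite !inE.
by move=> /eqP-> /eqP->; rewrite mulr0 addr0.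
Qed.

(** The monomials in f and in the three lifted fractions, with exponents below
    N and multiplied by a common denominator, are N^4 polynomials of degree at
    most 4 e N, hence linearly dependent for large N; the lowest power of f in
    the relation then yields a relation between the three fractions. *)
Lemma hypersurface_dependent (K : fieldType) (f : {mpoly K[3]})
    (pf : prime_elt f) (F : fieldType) (iota : {rmorphism {mpoly K[3]} -> F}) :
  (forall a, divides f a -> iota a = 0) ->
  (forall z, exists a b, iota b != 0 /\ z = iota a / iota b) ->
  forall x y t : F, exists N (c : 'I_N -> 'I_N -> 'I_N -> K),
  (exists i j k, c i j k != 0) /\
  \sum_i (\sum_j (\sum_k iota (c i j k)%:MP * t ^+ k) * y ^+ j) * x ^+ i = 0.
Proof.
move=> kf frac x y t.
have [a0 [b0 [nb0 ex]]] := frac x; have [a1 [b1 [nb1 ey]]] := frac y.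
have [a2 [b2 [nb2 et]]] := frac t.
pose e := (msize f + msize a0 + msize b0 + msize a1 + msize b1 + msize a2 +
  msize b2)%N.
have [N hN] : exists N, ((4 * e * N).+1 ^ 3 < N * (N * N * N))%N.
  pose N := ((4 * e).+1 ^ 3).+1; exists N.
  have le : ((4 * e * N).+1 <= (4 * e).+1 * N)%N.
    by rewrite [X in (_ <= X)%N]mulSn; lia.
  apply: (@leq_ltn_trans (((4 * e).+1 * N) ^ 3)); first by rewrite leq_exp2r.
  rewrite expnMn.
  rewrite (_ : N * (N * N * N) = N * N ^ 3)%N; last by rewrite !expnS expn0; ring.
  by rewrite ltn_pmul2r // expn_gt0.
(* The i-th power of a / b, with its denominator cleared by b^N. *)
pose hom (a b : {mpoly K[3]}) (i : 'I_N) := a ^+ i * b ^+ (N - i).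
pose g (u : 'I_N * 'I_N * 'I_N) :=
  hom a0 b0 u.1.1 * hom a1 b1 u.1.2 * hom a2 b2 u.2.
pose h (v : 'I_N * ('I_N * 'I_N * 'I_N)) := g v.2 * f ^+ v.1.
have shom a b i : (msize a <= e.+1)%N -> (msize b <= e.+1)%N ->
    (msize (hom a b i) <= (N * e).+1)%N.
  move=> sa sb; rewrite /hom.
  apply: leq_trans (msizeM_bound (msizeX_bound _ sa) (msizeX_bound _ sb)) _.
  by rewrite -mulnDl subnKC // ltnW.
have sh v : (msize (h v) <= (4 * e * N).+1)%N.
  have -> : (4 * e * N = N * e + N * e + N * e + N * e)%N by ring.
  apply: msizeM_bound; last first.
    apply: leq_trans (msizeX_bound (i := e) _ _) _; first by rewrite /e; lia.
    by rewrite ltnS leq_mul2r ltnW ?orbT.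
  by apply: msizeM_bound; [apply: msizeM_bound|]; apply: shom; rewrite /e; lia.
have [|c [[[l0 u0] cn0] c0]] := exists_linear_relation sh.
  by rewrite !card_prod !card_ord.
pose s l := \sum_u c (l, u) *: g u.
have es : \sum_l s l * f ^+ l = 0.
  rewrite -[RHS]c0 /s; under eq_bigr do rewrite mulr_suml.
  by rewrite pair_bigA; apply: eq_bigr => -[l u] _; rewrite -scalerAl.
have [||||||l /forallPn[u1 cn1]] :=
  @lowest_term_ideal _ (pred1 0) (principal_ideal pf) f N s
    (fun l => [forall u, c (l, u) == 0]) (prime_ideal0 _)
    (principal_idealr_closed pf).
- by move=> a; rewrite inE => /eqP ->; apply/principal_idealP; exists 0; rewrite mul0r.
- by have [] := pf.
- by apply/principal_idealP; exists 1; rewrite mul1r.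
- by move=> l /forallP z; apply: big1 => u _; rewrite (eqP (z u)) scale0r.
- by exists l0; apply/forallPn; exists u0.
- by rewrite es inE.
move=> /principal_idealP/kf e0.
exists N, (fun i j k => c (l, (i, j, k))); split.
  by case: u1 cn1 => [[i j] k] cn1; exists i, j, k.
have ihom a b (i : 'I_N) : iota b != 0 ->
    iota (hom a b i) = iota b ^+ N * (iota a / iota b) ^+ i.
  move=> nb; rewrite rmorphM !rmorphXn /= expr_div_n.
  rewrite -[in iota b ^+ N](subnK (ltnW (ltn_ord i))) exprD.
  by rewrite -mulrA [_ ^+ i * (_ / _)]mulrCA divff ?expf_neq0 // mulr1 mulrC.
clearbody hom.
pose B := iota b0 ^+ N * iota b1 ^+ N * iota b2 ^+ N.
have nB : B != 0 by rewrite !mulf_neq0 ?expf_neq0.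
apply: (mulfI nB); rewrite mulr0 -[RHS]e0 /s rmorph_sum mulr_sumr.
under eq_bigr do rewrite mulr_suml mulr_sumr.
under eq_bigr do under eq_bigr do rewrite !mulr_suml mulr_sumr.
rewrite !pair_bigA; apply: eq_bigr => -[[i j] k] _ /=.
rewrite -mul_mpolyC !rmorphM /= !ihom // -ex -ey -et /B; ring.
Qed.

Lemma hypersurface_chain_le2 (K : fieldType) (f : {mpoly K[3]})
    (pf : prime_elt f) m
    (P : 'I_m.+1 -> {pred reciprocal_complement (principal_quot pf)}) :
  prime_chain P -> (m <= 2)%N.
Proof.
set D := principal_quot pf in P *.
pose iota : {rmorphism {mpoly K[3]} -> {fraction D}} := quot_frac pf.
have ker : forall a, iota a = 0 <-> divides f a by exact: quot_frac_ker.
have in_R c : iota c%:MP \in @reciprocal_pred D.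
  have [->|c0] := eqVneq c 0; first by rewrite mpolyC0 rmorph0 rpred0.
  have e : iota (c^-1)%:MP * iota c%:MP = 1.
    by rewrite -rmorphM -mpolyCM mulVf ?mpolyC1 ?rmorph1.
  have n0 : iota (c^-1)%:MP != 0.
    by apply: contra_eq_neq e => ->; rewrite mul0r eq_sym oner_neq0.
  rewrite (_ : iota c%:MP = (iota (c^-1)%:MP)^-1); first exact: quot_frac_inv_in.
  by apply: (mulfI n0); rewrite e divff.
pose kappa c : reciprocal_complement D := exist _ (iota c%:MP) (in_R c).
apply: (@prime_chain_le2 K _ kappa).
- by apply: val_inj; rewrite /= mpolyC0 rmorph0.
- move=> c c0; exists (kappa c^-1); apply: val_inj => /=.
  by rewrite -rmorphM -mpolyCM mulVf ?mpolyC1 ?rmorph1.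
- move=> x y t; have [N [c [c0 e]]] := hypersurface_dependent pf
    (fun a => proj2 (ker a)) (@quot_fracE _ _ pf) (val x) (val y) (val t).
  exists N, c; split=> //; apply: val_inj; rewrite rmorph0 -[RHS]e rmorph_sum.
  apply: eq_bigr => i _; rewrite rmorphM rmorphXn rmorph_sum; congr (_ * _).
  apply: eq_bigr => j _; rewrite rmorphM rmorphXn rmorph_sum; congr (_ * _).
  by apply: eq_bigr => k _; rewrite rmorphM rmorphXn.
Qed.

(** * Weighted gradings of polynomial rings *)

Section Scaling.
Variables (K : fieldType) (n : nat).

Lemma mpoly_rmorph_ext (S : comNzRingType) (u v : {rmorphism {mpoly K[n]} -> S}) :
  (forall c, u c%:MP = v c%:MP) -> (forall i, u 'X_i = v 'X_i) -> u =1 v.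
Proof.
move=> eC eX p; rewrite [p]mpolyE !rmorph_sum; apply: eq_bigr => m _.
rewrite -mul_mpolyC !rmorphM eC; congr (_ * _); rewrite mpolyXE_id !rmorph_prod.
by apply: eq_bigr => i _; rewrite !rmorphXn eX.
Qed.

Variable w : 'I_n -> nat.

Definition weight (m : 'X_{1..n}) := (\sum_i m i * w i)%N.

(** The grading in which the variable of index i has degree w i. *)
Definition scaling : {mpoly K[n]} -> {poly {mpoly K[n]}} :=
  mmap (@polyC {mpoly K[n]} \o @mpolyC n K) (fun i => ('X_i)%:P * 'X^(w i)).

HB.instance Definition _ := GRing.RMorphism.on scaling.

Lemma scalingC c : scaling c%:MP = (c%:MP)%:P.
Proof. exact: mmapC. Qed.

Lemma scalingXi i : scaling 'X_i = ('X_i)%:P * 'X^(w i).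
Proof. by rewrite /scaling mmapX mmap1U. Qed.

Lemma scalingX m : scaling 'X_[m] = 'X_[m]%:P * 'X^(weight m).
Proof.
rewrite mpolyXE_id rmorph_prod /weight.
under eq_bigr do rewrite rmorphXn /= scalingXi exprMn -exprM mulnC -rmorphXn.
rewrite big_split /= -rmorph_prod -expr_sum.
by [].
Qed.

Lemma size_scalingXi i : size (scaling 'X_i) = (w i).+1.
Proof.
have X0 : 'X_i != 0 :> {mpoly K[n]} by rewrite -msize_poly_eq0 msizeX mdeg1.
by rewrite scalingXi mul_polyC size_scale // size_polyXn.
Qed.

Lemma scaling1 p : (scaling p).[1] = p.
Proof.
rewrite -[RHS]/(idfun p) -[LHS]/((horner_eval (1 : {mpoly K[n]}) \o scaling) p).
apply: mpoly_rmorph_ext => [c|i] /=; rewrite /horner_eval ?scalingC ?hornerC //.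
by rewrite scalingXi hornerM hornerC hornerXn expr1n mulr1.
Qed.

Lemma scaling_coef p i : scaling (scaling p)`_i = (scaling p)`_i *: 'X^i.
Proof.
rewrite [p]mpolyE rmorph_sum coef_sum rmorph_sum scaler_suml.
apply: eq_bigr => m _; rewrite -mul_mpolyC rmorphM /= scalingC scalingX.
rewrite mulrA -polyCM coefCM coefXn; have [->|_] := eqVneq i (weight m).
  by rewrite mulr1 rmorphM /= scalingC scalingX mulrA -polyCM mul_polyC.
by rewrite mulr0 rmorph0 scale0r.
Qed.

Lemma scaling_eq0 p : (scaling p == 0) = (p == 0).
Proof. by apply/eqP/eqP => [e|->]; rewrite ?rmorph0 // -[p]scaling1 e horner0. Qed.

Lemma mcoeff_scaling p i m :
  ((scaling p)`_i)@_m = if weight m == i then p@_m else 0.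
Proof.
rewrite {1}[p]mpolyE rmorph_sum coef_sum raddf_sum.
under eq_bigr => k _ do rewrite -mul_mpolyC rmorphM /= scalingC scalingX mulrA
  -polyCM coefCM coefXn /= mul_mpolyC.
have -> : (if weight m == i then p@_m else 0) =
    \sum_(k <- msupp p) (if weight m == i then p@_k * (k == m)%:R else 0).
  case: eqP => _; last by rewrite big1.
  by rewrite {1}[p]mpolyE raddf_sum; apply: eq_bigr => k _; rewrite /= mcoeffZ mcoeffX.
apply: eq_bigr => k _; rewrite mulr_natr mcoeffMn mcoeffZ mcoeffX [i == _]eq_sym.
have [->|nk] := eqVneq k m; last by rewrite mulr0 mul0rn if_same.
by case: eqP; rewrite ?mulr1n ?mulr0n.
Qed.

End Scaling.

(** * Polynomials in three variables *)

Lemma prime_elt_retract (A B : idomainType) (u : {rmorphism A -> B})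
    (v : {rmorphism B -> A}) (b : B) :
  cancel u v -> u (v b) = b -> prime_elt b -> prime_elt (v b).
Proof.
move=> uK eb [b0 bU bd]; split.
- by apply: contraNneq b0 => e; rewrite -eb e rmorph0.
- by apply: contra bU => h; rewrite -eb rmorph_unit.
move=> x y [c e]; have [|[z ez]|[z ez]] := bd (u x) (u y).
- by exists (u c); rewrite -rmorphM e rmorphM eb.
- by left; exists (v z); rewrite -[x]uK ez rmorphM.
- by right; exists (v z); rewrite -[y]uK ez rmorphM.
Qed.

Section ThreeVariables.
Variable K : fieldType.

Fact in_YZ_is_zmod_morphism : zmod_morphism (@in_YZ K).
Proof. by move=> a b; exact: comp_mpolyB. Qed.

Fact in_YZ_is_monoid_morphism : monoid_morphism (@in_YZ K).
Proof. by split=> [|a b]; [exact: comp_mpoly1 | exact: rmorphM]. Qed.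

HB.instance Definition _ := GRing.isZmodMorphism.Build _ _ (@in_YZ K)
  in_YZ_is_zmod_morphism.
HB.instance Definition _ := GRing.isMonoidMorphism.Build _ _ (@in_YZ K)
  in_YZ_is_monoid_morphism.

Lemma in_YZX0 : in_YZ ('X_ord0 : {mpoly K[2]}) = 'X_(inord 1).
Proof. by rewrite /in_YZ comp_mpolyXU. Qed.

Lemma in_YZX1 : in_YZ ('X_(inord 1) : {mpoly K[2]}) = 'X_(inord 2).
Proof. by rewrite /in_YZ comp_mpolyXU inordK. Qed.

Lemma in_YZC c : in_YZ (c%:MP : {mpoly K[2]}) = c%:MP.
Proof. exact: comp_mpolyC. Qed.

(** The identification of K[X,Y,Z] with K[Y,Z][X], along which primality of g in
    K[Y,Z] passes to K[X,Y,Z]. *)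
Definition poly_in_X : {mpoly K[3]} -> {poly {mpoly K[2]}} :=
  mmap (@polyC {mpoly K[2]} \o @mpolyC 2 K)
    (fun i : 'I_3 => if i == ord0 then 'X else ('X_(inord i.-1))%:P).

HB.instance Definition _ := GRing.RMorphism.on poly_in_X.

Definition of_poly_in_X : {poly {mpoly K[2]}} -> {mpoly K[3]} :=
  horner_eval 'X_ord0 \o map_poly (@in_YZ K).

HB.instance Definition _ := GRing.RMorphism.on of_poly_in_X.

Lemma poly_in_XC c : poly_in_X c%:MP = (c%:MP)%:P.
Proof. exact: mmapC. Qed.

Lemma poly_in_XX i :
  poly_in_X 'X_i = if i == ord0 then 'X else ('X_(inord i.-1))%:P.
Proof. by rewrite /poly_in_X mmapX mmap1U. Qed.

Lemma of_poly_in_XC q : of_poly_in_X q%:P = in_YZ q.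
Proof. by rewrite /of_poly_in_X /= map_polyC /horner_eval hornerC. Qed.

Lemma ord2P (i : 'I_2) : i = ord0 \/ i = inord 1.
Proof.
by case: i => [[|[|//]] lt]; [left|right]; apply: val_inj; rewrite /= ?inordK.
Qed.

Lemma ord3P (i : 'I_3) : [\/ i = ord0, i = inord 1 | i = inord 2].
Proof.
case: i => [[|[|[|//]]] lt].
- by apply: Or31; apply: val_inj.
- by apply: Or32; apply: val_inj; rewrite /= inordK.
- by apply: Or33; apply: val_inj; rewrite /= inordK.
Qed.

Lemma inord12 : ((inord 1 : 'I_3) != ord0) * ((inord 2 : 'I_3) != ord0).
Proof. by split; rewrite -val_eqE /= inordK. Qed.

Lemma poly_in_XK : cancel poly_in_X of_poly_in_X.
Proof.
move=> p; rewrite -[RHS]/(idfun p) -[LHS]/((of_poly_in_X \o poly_in_X) p).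
apply: mpoly_rmorph_ext => [c|i] /=.
  by rewrite poly_in_XC of_poly_in_XC in_YZC.
rewrite poly_in_XX.
case: (ord3P i) => ->; rewrite ?eqxx ?(negPf inord12.1) ?(negPf inord12.2).
- by rewrite /of_poly_in_X /= map_polyX /horner_eval hornerX.
- rewrite of_poly_in_XC inordK //= (_ : inord 0 = ord0) ?in_YZX0 //.
  by apply: val_inj; rewrite /= inordK.
- by rewrite of_poly_in_XC inordK //= in_YZX1.
Qed.

Lemma poly_in_X_in_YZ q : poly_in_X (in_YZ q) = q%:P.
Proof.
rewrite -[RHS]/(polyC q) -[LHS]/((poly_in_X \o @in_YZ K) q).
apply: mpoly_rmorph_ext => [c|i] /=; first by rewrite in_YZC poly_in_XC.
case: (ord2P i) => ->; rewrite ?in_YZX0 ?in_YZX1 poly_in_XX.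
  rewrite (negPf inord12.1) inordK //=; congr ('X_ _)%:P.
  by apply: val_inj; rewrite /= inordK.
by rewrite (negPf inord12.2) inordK.
Qed.

Lemma prime_in_YZ (g : {mpoly K[2]}) : irreducible_elt g -> prime_elt (in_YZ g).
Proof.
move=> ig; rewrite -of_poly_in_XC; apply: (@prime_elt_retract _ _ poly_in_X).
- exact: poly_in_XK.
- by rewrite /= of_poly_in_XC poly_in_X_in_YZ.
- by apply: prime_polyC; apply: irreducible_prime ig; exact: factorial_mpoly.
Qed.

Definition wX (i : 'I_3) : nat := i == ord0.
Definition wYZ (i : 'I_3) : nat := i != ord0.

Lemma weightX (m : 'X_{1..3}) : weight wX m = m ord0.
Proof.
rewrite /weight (bigD1 ord0) //= muln1 big1 ?addn0 // => i.
by rewrite /wX => /negPf ->; rewrite muln0.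
Qed.

Lemma weight_split (m : 'X_{1..3}) : (weight wX m + weight wYZ m = mdeg m)%N.
Proof.
rewrite /weight -big_split mdegE; apply: eq_bigr => i _ /=.
by rewrite -mulnDr /wX /wYZ; case: (i == ord0); rewrite muln1.
Qed.

Lemma scaling_in_YZ (q : {mpoly K[2]}) : scaling wX (in_YZ q) = (in_YZ q)%:P.
Proof.
rewrite -[RHS]/((polyC \o @in_YZ K) q) -[LHS]/((scaling wX \o @in_YZ K) q).
apply: mpoly_rmorph_ext => [c|i] /=; first by rewrite in_YZC scalingC.
by case: (ord2P i) => ->; rewrite ?in_YZX0 ?in_YZX1 scalingXi /wX
  ?(negPf inord12.1) ?(negPf inord12.2) mulr1.
Qed.

(** Read off from the grading by X, in which in_YZ q is homogeneous of
    degree 0. *)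
Lemma mcoeff_in_YZ (q : {mpoly K[2]}) (m : 'X_{1..3}) :
  m ord0 != 0%N -> (in_YZ q)@_m = 0.
Proof.
move=> m0; have := mcoeff_scaling wX (in_YZ q) (m ord0) m.
by rewrite weightX eqxx scaling_in_YZ coefC (negPf m0) mcoeff0 => <-.
Qed.

Lemma mcoeff_pihomog d (q : {mpoly K[3]}) m :
  (pihomog mdeg d q)@_m = if mdeg m == d then q@_m else 0.
Proof.
rewrite pihomogE raddf_sum.
have [e|ne] := eqVneq (mdeg m) d; last first.
  apply: big1 => k /eqP ek; rewrite /= mcoeffZ mcoeffX.
  by case: eqP => [e|]; rewrite ?mulr0 //; move: ne; rewrite -e ek eqxx.
rewrite [in RHS](mpolyE q) raddf_sum big_mkcond; apply: eq_bigr => k _ /=.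
rewrite mcoeffZ mcoeffX; have [->|] := eqVneq k m; first by rewrite e eqxx.
by rewrite mulr0 if_same.
Qed.

Lemma mcoeff_X0d d (m : 'X_{1..3}) :
  ('X_ord0 ^+ d : {mpoly K[3]})@_m = ((mdeg m == d) && (weight wYZ m == 0%N))%:R.
Proof.
rewrite mcoeffXn; congr (_%:R); congr (nat_of_bool _).
apply/eqP/andP => [<-|[/eqP e /eqP e0]].
  split; first by rewrite mdegMn mdeg1 mul1n.
  rewrite /weight big1 // => i _; rewrite mulmnE mnm1E /wYZ [i == _]eq_sym.
  by case: (ord0 == i); rewrite ?muln0.
have := weight_split m; rewrite e0 addn0 weightX e => m0.
apply/mnmP => i; rewrite mulmnE mnm1E; have [<-|ne] := eqVneq; first by rewrite mul1n.
move/eqP: e0; rewrite /weight sum_nat_eq0 => /forallP/(_ i) /=.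
by rewrite /wYZ [i == _]eq_sym ne muln1 mul0n => /eqP.
Qed.

(** In degree d for the grading by Y and Z, f has no monomial of total degree
    above d, and those of total degree d and (Y,Z)-degree d do not involve X;
    the latter make up in_YZ g, as X^d has (Y,Z)-degree 0. *)
Lemma scaling_lead (f : {mpoly K[3]}) d (g : {mpoly K[2]}) : (0 < d)%N ->
  msize f = d.+1 -> pihomog mdeg d f = 'X_ord0 ^+ d + in_YZ g ->
  in_YZ g != 0 ->
  size (scaling wYZ f) = d.+1 /\ lead_coef (scaling wYZ f) = in_YZ g.
Proof.
move=> d0 sf ef g0.
have big m : (d < mdeg m)%N -> f@_m = 0.
  by move=> h; apply/eqP; rewrite mcoeff_eq0 msize_mdeg_ge // sf.
have wle m : (weight wYZ m <= mdeg m)%N by rewrite -weight_split leq_addl.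
have hi i : (d < i)%N -> (scaling wYZ f)`_i = 0.
  move=> di; apply/mpolyP => m; rewrite mcoeff_scaling mcoeff0.
  by case: eqP => // e; apply: big; rewrite (leq_trans di) // -e.
have hd : (scaling wYZ f)`_d = in_YZ g.
  apply/mpolyP => m; rewrite mcoeff_scaling.
  have := congr1 (mcoeff m) ef; rewrite mcoeffD mcoeff_pihomog mcoeff_X0d.
  have [e|ne] := eqVneq (weight wYZ m) d.
    rewrite e (gtn_eqF d0) andbF add0r => <-.
    case: eqP => // ne; apply: big; move: (wle m); rewrite e; lia.
  move=> h; have [m0|m0] := eqVneq (m ord0) 0%N; last by rewrite mcoeff_in_YZ.
  have em : weight wYZ m = mdeg m by rewrite -weight_split weightX m0.
  by move: h; rewrite -em (negPf ne) andFb add0r.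
have sz : size (scaling wYZ f) = d.+1.
  apply/eqP; rewrite eqn_leq; apply/andP; split.
    by apply/leq_sizeP => i di; apply: hi.
  rewrite ltnNge; apply/negP => /leq_sizeP/(_ d (leqnn d))/eqP.
  by rewrite hd (negPf g0).
by split=> //; rewrite /lead_coef sz hd.
Qed.

End ThreeVariables.
Theorem proposition6p8 (K : fieldType) (p : nat) (p_char : has_characteristic K p)
    (f : {mpoly K[3]}) (f_irr : irreducible_elt f)
    (d : nat) (f_deg : msize f = d.+1) (d_prime : prime d) (p_ndvd_d : ~~ (p %| d)%N)
    (g : {mpoly K[2]})
    (fd_irr : irreducible_elt (pihomog mdeg d f))
    (fd_eq : pihomog mdeg d f = 'X_ord0 ^+ d + in_YZ g)
    (g_irr : irreducible_elt g) :
  has_krull_dim (reciprocal_complement (hypersurface_ring f_irr)) 2.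
Proof.
have d0 := prime_gt0 d_prime.
have g_prime := prime_in_YZ g_irr.
have [sf lf] : size (scaling wYZ f) = d.+1 /\ lead_coef (scaling wYZ f) = in_YZ g.
  by apply: scaling_lead => //; have [] := g_prime.
have sY : size (scaling wYZ ('X_(inord 1) : {mpoly K[3]})) = 2.
  by rewrite size_scalingXi /wYZ inord12.1.
split; last by move=> m P; exact: hypersurface_chain_le2.
apply: (@reciprocal_chain2 _ _ f 'X_ord0 'X_(inord 1) _
  (scaling wYZ) (scaling wX)).
- exact: scaling1.
- exact: scaling_coef.
- by rewrite lf.
- exact: scaling_eq0.
- by rewrite /flat [LHS]scalingXi mulr1.
- by rewrite size_scalingXi.
- apply/andP; split; first by rewrite sY.
  by apply: (leq_trans (n := d.+1)); [rewrite sY ltnS prime_gt1 | rewrite sf].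
Qed.
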